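(* Let $(\mathbf G_n)_{n\ge0}$ be a sequence of pointed finite connected graphs, and let $(r_n)_{n\ge0}$ be a sequence of positive real numbers converging to $0$. Suppose that $r_n\cdot\mathbf G_n$ converges to a pointed compact metric space $\mathbf E$ in the sense of the Gromov-Hausdorff distance. Then $r_n\cdot\mathrm{Cac}(\mathbf G_n)$ converges to $\mathrm{Kac}(\mathbf E)$ in the sense of the Gromov-Hausdorff distance.
   Context: The Gromov-Hausdorff distance is the one between pointed compact metric spaces: $d_{\mathrm{GH}}((E,d,\rho),(E',d',\rho'))=\inf\{d_{\mathrm H}^F(\phi(E),\phi'(E'))\vee\delta(\phi(\rho),\phi'(\rho'))\}$ over metric spaces $(F,\delta)$ and isometric embeddings $\phi:E\to F,\phi':E'\to F$, with $d^F_{\mathrm H}$ the Hausdorff distance. A pointed graph $\mathbf G=(V,\mathcal E,\rho)$ (finite, connected, simple, with $\rho\in V$) is identified with the pointed metric space $(V,d_{gr},\rho)$, where $d_{gr}$ is the graph distance. $r\cdot X$ denotes the metric space $X$ with distances multiplied by $r$. **Discrete cactus.** For $v,v'\in V$ set $d^{\mathbf G}_{\mathrm{Cac}}(v,v')=d_{gr}(\rho,v)+d_{gr}(\rho,v')-2\max_{\gamma:v\to v'}\min_{a\in\gamma}d_{gr}(\rho,a)$, the maximum being over all paths from $v$ to $v'$ in the graph. $\mathrm{Cac}(\mathbf G)$ is the quotient of $V$ by $\{d^{\mathbf G}_{\mathrm{Cac}}=0\}$ with the induced distance, pointed at the class of $\rho$. **Continuous cactus.** For a pointed geodesic compact metric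 space $\mathbf E=(E,d,\rho)$ set $d^{\mathbf E}_{\mathrm{Kac}}(a,b)=d(\rho,a)+d(\rho,b)-2\sup_{\gamma:a\to b}\min_{0\le t\le1}d(\rho,\gamma(t))$, the supremum being over continuous curves $\gamma:[0,1]\to E$ from $a$ to $b$. $\mathrm{Kac}(\mathbf E)$ is the quotient of $E$ by $\{d^{\mathbf E}_{\mathrm{Kac}}=0\}$ with the induced distance, pointed at the class of $\rho$. Under the hypotheses of the claim, the limit $\mathbf E$ is necessarily a geodesic space, so that $\mathrm{Kac}(\mathbf E)$ is well defined. *)

(* Defs.v *)
From HB Require Import structures.
From mathcomp Require Import all_boot all_order all_algebra.
From mathcomp Require Import all_classical all_reals interval_inference.
From mathcomp Require Import ereal topology normedtype sequences.
From mathcomp Require Import lra.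

Set Implicit Arguments.
Unset Strict Implicit.
Unset Printing Implicit Defensive.

Import Order.TTheory GRing.Theory Num.Theory.
Import numFieldNormedType.Exports.

Local Open Scope classical_set_scope.
Local Open Scope ring_scope.
Local Open Scope quotient_scope.

Lemma lipschitz_onto_compact (R : realType) (X Y : metricType R) (f : X -> Y)
    (C : R) : 0 < C -> (forall x y, mdist (f x) (f y) <= C * mdist x y) ->
  (forall y, exists x, f x = y) -> compact [set: X] -> compact [set: Y].
Proof.
move=> C0 lip onto cX.
have -> : [set: Y] = f @` [set: X].
  by apply/seteqP; split => // y _; have [x <-] := onto y; exists x.
apply: continuous_compact => //; apply: continuous_subspaceT => x.
apply/metricType_numDomainType.cvgrPdist_lt => e e0; near=> y.
rewrite (le_lt_trans (lip _ _))// mulrC -ltr_pdivlMr//.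
by near: y; apply: metricType_numDomainType.cvgr_dist_lt;
  [exact: cvg_id|rewrite divr_gt0].
Unshelve. all: by end_near. Qed.

Record pcMetric (R : realType) := PCMetric {
  space :> metricType R;
  base : space;
  space_compact : compact [set: space] }.

Arguments base {R} _.

(* Hausdorff and Gromov-Hausdorff distances are taken in the extended reals,
   so that no convention is needed for unbounded sets or empty infima; they are
   finite on the compact sets and spaces of interest. *)
Definition hausdorff_dist (R : realType) (F : metricType R) (A B : set F) :
    \bar R :=
  ereal_inf [set e%:E | e in [set e : R | [/\ 0 < e,
    A `<=` \bigcup_(b in B) ball b e & B `<=` \bigcup_(a in A) ball a e]]].

Definition isometric (R : realType) (X Y : metricType R) (f : X -> Y) : Prop :=
  forall x y, mdist (f x) (f y) = mdist x y.

Definition gh_dist (R : realType) (X Y : pcMetric R) : \bar R :=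
  ereal_inf [set v | exists (F : metricType R) (f : X -> F) (g : Y -> F),
    [/\ isometric f, isometric g
      & v = maxe (hausdorff_dist (range f) (range g))
                 (mdist (f (base X)) (g (base Y)))%:E]].

Definition gh_cvg (R : realType) (X : nat -> pcMetric R) (Y : pcMetric R) :
    Prop :=
  gh_dist (X n) Y @[n --> \oo] --> 0%E.

Definition rescaled (R : realType) (r : {posnum R}) (X : metricType R) : Type :=
  X.

Section Rescaled.
Context {R : realType} (r : {posnum R}) (X : metricType R).

HB.instance Definition _ := Choice.on (rescaled r X).

Let dist (x y : rescaled r X) : R := r%:num * mdist (x : X) (y : X).

Let dist_xx x : dist x x = 0.
Proof. by rewrite /dist mdistxx mulr0. Qed.

Let dist_eq0 x y : dist x y = 0 -> x = y.
Proof.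
move=> /eqP; rewrite mulf_eq0 gt_eqF//= => /eqP; exact: mdist_positivity.
Qed.

Let dist_sym x y : dist x y = dist y x.
Proof. by rewrite /dist metric_sym. Qed.

Let dist_triangle y x z : dist x z <= dist x y + dist y z.
Proof. by rewrite -mulrDr ler_pM2l//; exact: metric_triangle. Qed.

HB.instance Definition _ := isMetric.Build R (rescaled r X)
  dist_xx dist_eq0 dist_sym dist_triangle.

Lemma mdist_rescaled (x y : X) :
  mdist (x : rescaled r X) (y : rescaled r X) = r%:num * mdist x y.
Proof. by []. Qed.

End Rescaled.

Lemma rescaled_compact (R : realType) (r : {posnum R}) (X : pcMetric R) :
  compact [set: rescaled r X].
Proof.
apply: (@lipschitz_onto_compact R X (rescaled r X) id r%:num) => //.
- by move=> y; exists y.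
- exact: space_compact.
Qed.

Definition rescale (R : realType) (r : {posnum R}) (X : pcMetric R) :
    pcMetric R :=
  @PCMetric R (rescaled r X) (base X) (@rescaled_compact R r X).

Record pseudoDist (R : realType) (T : Type) := PseudoDist {
  pdist :> T -> T -> R;
  pdistxx : forall x, pdist x x = 0;
  pdist_sym : forall x y, pdist x y = pdist y x;
  pdist_triangle : forall y x z, pdist x z <= pdist x y + pdist y z }.

Section Quotient.
Context {R : realType} {T : choiceType} (d : pseudoDist R T).

Lemma pdist_ge0 x y : 0 <= d x y.
Proof.
by have := pdist_triangle d y x x; rewrite pdistxx (pdist_sym d y x); lra.
Qed.

Definition pd_eq : rel T := fun x y => d x y == 0.

Let pd_eq_refl : reflexive pd_eq.
Proof. by move=> x; rewrite /pd_eq pdistxx. Qed.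

Let pd_eq_sym : symmetric pd_eq.
Proof. by move=> x y; rewrite /pd_eq pdist_sym. Qed.

Let pd_eq_trans : transitive pd_eq.
Proof.
move=> y x z /eqP xy /eqP yz; rewrite /pd_eq eq_le pdist_ge0 andbT.
by rewrite (le_trans (pdist_triangle d y x z))// xy yz addr0.
Qed.

Canonical pd_equiv := EquivRel pd_eq pd_eq_refl pd_eq_sym pd_eq_trans.

Definition mquot : Type := {eq_quot pd_equiv}.

HB.instance Definition _ := Choice.on mquot.

Definition mclass (x : T) : mquot := \pi_({eq_quot pd_equiv}) x.

Definition mrepr (q : mquot) : T := repr (q : {eq_quot pd_equiv}).

Lemma mclassP (x y : T) : mclass x = mclass y <-> d x y = 0.
Proof. by split=> [/eqquotP/eqP//|xy]; apply/eqquotP/eqP. Qed.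

Lemma mreprK (q : mquot) : mclass (mrepr q) = q.
Proof. exact: reprK. Qed.

Let dist (p q : mquot) : R := d (mrepr p) (mrepr q).

Let dist_xx x : dist x x = 0. Proof. exact: pdistxx. Qed.

Let dist_eq0 x y : dist x y = 0 -> x = y.
Proof. by move=> /mclassP; rewrite !mreprK. Qed.

Let dist_sym x y : dist x y = dist y x. Proof. exact: pdist_sym. Qed.

Let dist_triangle y x z : dist x z <= dist x y + dist y z.
Proof. exact: pdist_triangle. Qed.

HB.instance Definition _ := isMetric.Build R mquot
  dist_xx dist_eq0 dist_sym dist_triangle.

Lemma mdist_mclass (x y : T) : mdist (mclass x) (mclass y) = d x y.
Proof.
have e (z : T) : d (mrepr (mclass z)) z = 0 by apply/mclassP/mreprK.
change (d (mrepr (mclass x)) (mrepr (mclass y)) = d x y).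
have ex := e x; have ey := e y.
apply/eqP; rewrite eq_le; apply/andP; split.
- have := pdist_triangle d x (mrepr (mclass x)) (mrepr (mclass y)).
  have := pdist_triangle d y x (mrepr (mclass y)).
  by rewrite (pdist_sym d y (mrepr _)); lra.
- have := pdist_triangle d (mrepr (mclass x)) x y.
  have := pdist_triangle d (mrepr (mclass y)) (mrepr (mclass x)) y.
  by rewrite (pdist_sym d x (mrepr _)); lra.
Qed.

End Quotient.

Record pgraph := PGraph {
  vert :> finType;
  adj : rel vert;
  root : vert;
  adj_sym : symmetric adj;
  adj_irr : irreflexive adj;
  adj_connected : forall x y : vert, connect adj x y }.

Arguments root : clear implicits.

(* The path from [x] to [y] is the vertex sequence [x :: p]; it has [size p]
   edges. *)
Definition gpath (G : pgraph) (x y : G) (p : seq G) : bool :=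
  path (@adj G) x p && (last x p == y).

Section GraphDistance.
Context (G : pgraph).
Implicit Types x y z : G.

Lemma gpath_exists x y : exists p, gpath x y p.
Proof.
by have /connectP[p px ->] := adj_connected x y; exists p; rewrite /gpath px/=.
Qed.

Lemma gpath_nil x : gpath x x [::].
Proof. by rewrite /gpath/= eqxx. Qed.

Lemma gpath_cat x y z p q : gpath x y p -> gpath y z q -> gpath x z (p ++ q).
Proof.
by rewrite /gpath cat_path last_cat => /andP[-> /eqP->] /andP[-> ->].
Qed.

Lemma gpath_rev x y p : gpath x y p -> gpath y x (rev (belast x p)).
Proof.
move=> /andP[px /eqP<-]; rewrite /gpath rev_path.
rewrite (eq_path (e' := @adj G)) ?px/=; last by move=> u v; rewrite adj_sym.
by case: p {px} => //= u p; rewrite rev_cons last_rcons.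
Qed.

Lemma gdist_subproof x y : exists n, [exists p : n.-tuple G, gpath x y p].
Proof.
have [p xpy] := gpath_exists x y.
by exists (size p); apply/existsP; exists (in_tuple p).
Qed.

Definition gdist x y : nat := ex_minn (gdist_subproof x y).

Lemma gdist_path x y : exists2 p, gpath x y p & size p = gdist x y.
Proof.
rewrite /gdist; case: ex_minnP => n /existsP[p xpy] _.
by exists p => //; rewrite size_tuple.
Qed.

Lemma gdist_le x y p : gpath x y p -> (gdist x y <= size p)%N.
Proof.
move=> xpy; rewrite /gdist; case: ex_minnP => n _; apply.
by apply/existsP; exists (in_tuple p).
Qed.

Lemma gdistxx x : gdist x x = 0%N.
Proof. by apply/eqP; rewrite -leqn0 (gdist_le (gpath_nil x)). Qed.

Lemma gdist_eq0 x y : gdist x y = 0%N -> x = y.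
Proof.
by have [p /andP[_ /eqP<-] <-] := gdist_path x y; case: p.
Qed.

Lemma gdist_sym x y : gdist x y = gdist y x.
Proof.
suff le u v : (gdist u v <= gdist v u)%N by apply/eqP; rewrite eqn_leq !le.
have [p vpu <-] := gdist_path v u.
by rewrite (leq_trans (gdist_le (gpath_rev vpu)))// size_rev size_belast.
Qed.

Lemma gdist_triangle y x z : (gdist x z <= gdist x y + gdist y z)%N.
Proof.
have [p xpy <-] := gdist_path x y; have [q yqz <-] := gdist_path y z.
by rewrite -size_cat (gdist_le (gpath_cat xpy yqz)).
Qed.

End GraphDistance.

Definition gspace (R : realType) (G : pgraph) : Type := G.

Section GraphSpace.
Context (R : realType) (G : pgraph).

HB.instance Definition _ := Choice.on (gspace R G).

Let dist (x y : gspace R G) : R := (gdist (x : G) (y : G))%:R.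

Let dist_xx x : dist x x = 0.
Proof. by rewrite /dist gdistxx. Qed.

Let dist_eq0 x y : dist x y = 0 -> x = y.
Proof. by move=> /eqP; rewrite pnatr_eq0 => /eqP/gdist_eq0. Qed.

Let dist_sym x y : dist x y = dist y x.
Proof. by rewrite /dist gdist_sym. Qed.

Let dist_triangle y x z : dist x z <= dist x y + dist y z.
Proof. by rewrite -natrD ler_nat gdist_triangle. Qed.

HB.instance Definition _ := isMetric.Build R (gspace R G)
  dist_xx dist_eq0 dist_sym dist_triangle.

Lemma mdist_gspace (x y : G) :
  mdist (x : gspace R G) (y : gspace R G) = (gdist x y)%:R.
Proof. by []. Qed.

Lemma gspace_compact : compact [set: gspace R G].
Proof. by apply: finite_compact; exact: (@finite_finset G). Qed.

Definition graph_space : pcMetric R :=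
  @PCMetric R (gspace R G) (root G) gspace_compact.

End GraphSpace.

Section Cac.
Context (R : realType) (G : pgraph).
Implicit Types v w : G.

Local Notation height := (gdist (root G)).

Definition path_min v (p : seq G) : nat :=
  \big[minn/height v]_(a <- p) height a.

Lemma leq_path_min k v p :
  (k <= path_min v p)%N = all (fun a => (k <= height a)%N) (v :: p).
Proof.
rewrite /path_min; elim: p => [|a p IH]; first by rewrite big_nil/= andbT.
by rewrite big_cons leq_min IH/= andbCA.
Qed.

Definition is_path_min v w : pred nat :=
  fun m => `[< exists2 p, gpath v w p & path_min v p = m >].

Lemma is_path_min_ex v w : exists m, is_path_min v w m.
Proof.
have [p vpw] := gpath_exists v w.
by exists (path_min v p); apply/asboolP; exists p.
Qed.

Lemma is_path_min_bound v w m : is_path_min v w m -> (m <= height v)%N.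
Proof.
move=> /asboolP[p _ <-].
by have := leqnn (path_min v p); rewrite leq_path_min => /andP[].
Qed.

Definition max_path_min v w : nat :=
  ex_maxn (is_path_min_ex v w) (@is_path_min_bound v w).

Definition dCac v w : R :=
  (height v)%:R + (height w)%:R - 2 * (max_path_min v w)%:R.

Lemma leq_max_path_min k v w : (k <= max_path_min v w)%N <->
  exists2 p, gpath v w p & all (fun a => (k <= height a)%N) (v :: p).
Proof.
rewrite /max_path_min; case: ex_maxnP => m /asboolP[p vpw <-] max; split.
  by rewrite leq_path_min => kp; exists p.
move=> [q vqw]; rewrite -leq_path_min => /leq_trans; apply; apply: max.
by apply/asboolP; exists q.
Qed.

Lemma max_path_min_le v w : (max_path_min v w <= height v)%N.
Proof. by have /leq_max_path_min[p _ /andP[]] := leqnn (max_path_min v w). Qed.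

Lemma max_path_minxx v : max_path_min v v = height v.
Proof.
apply/eqP; rewrite eqn_leq max_path_min_le/=; apply/leq_max_path_min.
by exists [::]; [exact: gpath_nil|rewrite /= leqnn].
Qed.

Lemma max_path_min_sym v w : max_path_min v w = max_path_min w v.
Proof.
suff le u t : (max_path_min u t <= max_path_min t u)%N.
  by apply/eqP; rewrite eqn_leq !le.
have /leq_max_path_min[p upt pm] := leqnn (max_path_min u t).
apply/leq_max_path_min; exists (rev (belast u p)); first exact: gpath_rev.
by case/andP: upt pm => _ /eqP<- pm; rewrite -rev_rcons -lastI all_rev.
Qed.

Lemma max_path_min_triangle u v w :
  (minn (max_path_min v u) (max_path_min u w) <= max_path_min v w)%N.
Proof.
set k := minn _ _.
have /leq_max_path_min[p vpu /= /andP[kv kp]] : (k <= max_path_min v u)%N.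
  exact: geq_minl.
have /leq_max_path_min[q uqw /= /andP[_ kq]] : (k <= max_path_min u w)%N.
  exact: geq_minr.
apply/leq_max_path_min; exists (p ++ q); first exact: gpath_cat uqw.
by rewrite /= all_cat kv kp kq.
Qed.

Let dCac_xx v : dCac v v = 0.
Proof. by rewrite /dCac max_path_minxx; lra. Qed.

Let dCac_sym v w : dCac v w = dCac w v.
Proof. by rewrite /dCac max_path_min_sym; lra. Qed.

Let dCac_triangle u v w : dCac v w <= dCac v u + dCac u w.
Proof.
rewrite /dCac.
have := max_path_min_triangle u v w.
have := max_path_min_le u w; have := max_path_min_le u v.
rewrite (max_path_min_sym u v) geq_min -!(ler_nat R).
by move=> ? ? /orP[] ?; lra.
Qed.

Definition Cac_dist : pseudoDist R G :=
  PseudoDist dCac_xx dCac_sym dCac_triangle.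

Lemma Cac_compact : compact [set: mquot Cac_dist].
Proof.
apply: finite_compact.
apply: (@sub_finite_set _ _ (@mclass R G Cac_dist @` [set: G])).
  by move=> q _; exists (mrepr q) => //; exact: mreprK.
by apply: finite_image; exact: (@finite_finset G).
Qed.

Definition Cac : pcMetric R :=
  @PCMetric R (mquot Cac_dist) (mclass Cac_dist (root G)) Cac_compact.

End Cac.

Definition geodesic (R : realType) (X : metricType R) : Prop :=
  forall a b : X, exists f : R -> X, [/\ f 0 = a, f (mdist a b) = b
    & {in `[0, mdist a b] &, forall s t, mdist (f s) (f t) = `|s - t|}].

Record pgcMetric (R : realType) := PGCMetric {
  pgc_space :> pcMetric R;
  pgc_geodesic : geodesic pgc_space }.

Arguments pgc_geodesic {R} _.

(* Only the values of [g] on [0, 1] matter. *)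
Definition curve (R : realType) (X : metricType R) (a b : X) : set (R -> X) :=
  [set g | [/\ {within `[(0 : R), 1], continuous g}, g 0 = a & g 1 = b]].

Section Curves.
Context {R : realType} {X : metricType R}.
Implicit Types a b c : X.

Lemma within_continuousP (A : set R) (g : R -> X) :
  {within A, continuous g} <->
  forall t, A t -> forall e, 0 < e -> exists2 k, 0 < k &
    forall s, A s -> `|t - s| < k -> mdist (g t) (g s) < e.
Proof.
split=> [/subspace_continuousP cg t At e e0|cg].
- have := metricType_numDomainType.cvgr_dist_lt (cg t At) e0.
  rewrite near_withinE => /(_ _)/nbhs_ballP[k /= k0 kP].
  by exists k => // s As ts; apply: (kP s ts).
- apply/subspace_continuousP => t At.
  apply/metricType_numDomainType.cvgrPdist_lt => e e0.
  have [k k0 kP] := cg t At e e0.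
  by rewrite near_withinE; apply/(nbhs_ballP t _); exists k => // s/= ts As; exact: kP.
Qed.

Lemma curve_cst a : curve a a (fun=> a).
Proof. by split=> //; apply: continuous_subspaceT => x; exact: cvg_cst. Qed.

Lemma curve_rev a b g : curve a b g -> curve b a (fun t => g (1 - t)).
Proof.
move=> [cg g0 g1]; split; rewrite ?subr0 ?subrr//.
apply/within_continuousP => t; rewrite /= in_itv/= => /andP[t0 t1] e e0.
have /within_continuousP/(_ (1 - t)) := cg.
rewrite /= in_itv/= subr_ge0 t1 gerBl t0 => /(_ isT e e0)[k k0 kP].
exists k => // s; rewrite /= in_itv/= => /andP[s0 s1] ts; apply: kP.
  by rewrite /= in_itv/= subr_ge0 s1 gerBl.
by rewrite (_ : _ - _ = s - t) 1?distrC//; lra.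
Qed.

Definition curve_cat (g h : R -> X) : R -> X :=
  fun t => if t <= 2^-1 then g (2 * t) else h (2 * t - 1).

Lemma curve_catP a b c g h : curve a b g -> curve b c h ->
  curve a c (curve_cat g h).
Proof.
move=> [cg g0 g1] [ch h0 h1].
have hg t : 2^-1 <= t -> curve_cat g h t = h (2 * t - 1).
  rewrite /curve_cat le_eqVlt => /predU1P[<-|]; last by rewrite ltNge => /negbTE->.
  by rewrite lexx divff// g1 subrr h0.
split; last 2 first.
- by rewrite /curve_cat invr_ge0 ler0n mulr0.
- by rewrite hg ?mulr1 ?invf_le1 ?ler1n// (_ : 2 - 1 = 1 :> R)//; lra.
have -> : [set` `[(0:R), 1]] = [set` `[(0:R), 2^-1]] `|` [set` `[(2^-1:R), 1]].
  apply/seteqP; split=> t /=; rewrite !in_itv/=; last first.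
    by case=> /andP[? ?]; apply/andP; split; lra.
  move=> /andP[t0 t1]; have [t2|/ltW t2] := leP t 2^-1; [left|right];
  by rewrite ?t0 ?t2 ?t1.
apply: withinU_continuous; [exact: interval_closed|exact: interval_closed| |].
- apply/within_continuousP => t; rewrite /= in_itv/= => /andP[t0 t1] e e0.
  have /within_continuousP/(_ (2 * t)) := cg.
  rewrite /= in_itv/= => /(_ _ e e0)[|k k0 kP]; first by apply/andP; split; lra.
  exists (k / 2) => [|s]; first by rewrite divr_gt0.
  rewrite /= in_itv/= => /andP[s0 s1] ts; rewrite /curve_cat t1 s1.
  apply: kP; first by rewrite /= in_itv/=; apply/andP; split; lra.
  by rewrite -mulrBr normrM ger0_norm// mulrC -ltr_pdivlMr.
- apply/within_continuousP => t; rewrite /= in_itv/= => /andP[t0 t1] e e0.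
  have /within_continuousP/(_ (2 * t - 1)) := ch.
  rewrite /= in_itv/= => /(_ _ e e0)[|k k0 kP]; first by apply/andP; split; lra.
  exists (k / 2) => [|s]; first by rewrite divr_gt0.
  rewrite /= in_itv/= => /andP[s0 s1] ts; rewrite !hg//.
  apply: kP; first by rewrite /= in_itv/=; apply/andP; split; lra.
  rewrite (_ : _ - _ = 2 * (t - s)); last lra.
  by rewrite normrM ger0_norm// mulrC -ltr_pdivlMr.
Qed.

Lemma geodesic_curve a b : geodesic X -> exists2 g, curve a b g &
  forall t, t \in `[(0 : R), 1] ->
    mdist a (g t) + mdist (g t) b = mdist a b.
Proof.
move=> /(_ a b)[f [f0 f1 iso]].
have D0 : 0 <= mdist a b by exact: mdist_ge0.
have inD t : t \in `[(0 : R), 1] -> t * mdist a b \in `[0, mdist a b].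
  rewrite !in_itv/= => /andP[t0 t1].
  by rewrite mulr_ge0//= ler_piMl.
have oD : 0 \in `[0, mdist a b] by rewrite in_itv/= lexx D0.
have iD : mdist a b \in `[0, mdist a b] by rewrite in_itv/= lexx D0.
exists (fun t => f (t * mdist a b)).
  split; rewrite ?mul0r ?mul1r//.
  apply/within_continuousP => t t01 e e0.
  exists (e / (mdist a b + 1)); first by rewrite divr_gt0// ltr_wpDl.
  move=> s s01; rewrite ltr_pdivlMr ?ltr_wpDl// => tse.
  rewrite iso ?inD// -mulrBl normrM (ger0_norm D0) (le_lt_trans _ tse)//.
  by rewrite ler_wpM2l// lerDl.
move=> t t01; have := inD _ t01; rewrite in_itv/= => /andP[u v].
have -> : mdist a (f (t * mdist a b)) = mdist (f 0) (f (t * mdist a b)).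
  by rewrite f0.
have -> : mdist (f (t * mdist a b)) b = mdist (f (t * mdist a b)) (f (mdist a b)).
  by rewrite f1.
rewrite !iso ?inD// sub0r normrN ger0_norm// ler0_norm; first by lra.
by rewrite subr_le0.
Qed.

End Curves.

Section Kac.
Context {R : realType} (E : pgcMetric R).
Implicit Types a b c : E.

Local Notation height := (mdist (base E)).

(* By compactness of [0, 1], the infimum is attained when [g] is a curve. *)
Definition curve_min (g : R -> E) : R := inf [set height (g t) | t in `[(0 : R), 1]].

Definition sup_curve_min a b : R := sup [set curve_min g | g in curve a b].

Definition dKac a b : R := height a + height b - 2 * sup_curve_min a b.

Let cm_has_inf (g : R -> E) : has_inf [set height (g t) | t in `[(0 : R), 1]].
Proof.
split; first by exists (height (g 0)), 0 => //=; rewrite in_itv/= lexx ler01.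
by exists 0 => _ [t _ <-]; exact: mdist_ge0.
Qed.

Lemma curve_min_le (g : R -> E) t : t \in `[(0 : R), 1] -> curve_min g <= height (g t).
Proof. by move=> t01; apply: ge_inf; [exact: (cm_has_inf g).2|exists t]. Qed.

Lemma curve_min_ge (g : R -> E) x :
  (forall t, t \in `[(0 : R), 1] -> x <= height (g t)) -> x <= curve_min g.
Proof.
by move=> xg; apply: lb_le_inf => [|_ [t t01 <-]];
  [exact: (cm_has_inf g).1|exact: xg].
Qed.

Lemma curve_min_le_start a b g : curve a b g -> curve_min g <= height a.
Proof.
by move=> [_ <- _]; apply: curve_min_le; rewrite in_itv/= lexx ler01.
Qed.

Let scm_has_sup a b : has_sup [set curve_min g | g in curve a b].
Proof.
split.
  have [g abg _] := geodesic_curve a b (pgc_geodesic E).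
  by exists (curve_min g), g.
by exists (height a) => _ [g abg <-]; exact: curve_min_le_start abg.
Qed.

Lemma sup_curve_min_ge a b g : curve a b g -> curve_min g <= sup_curve_min a b.
Proof. by move=> abg; apply: ub_le_sup; [exact: (scm_has_sup a b).2|exists g]. Qed.

Lemma sup_curve_min_le a b x :
  (forall g, curve a b g -> curve_min g <= x) -> sup_curve_min a b <= x.
Proof.
by move=> gx; apply: ge_sup => [|_ [g abg <-]];
  [exact: (scm_has_sup a b).1|exact: gx].
Qed.

Lemma sup_curve_min_le_start a b : sup_curve_min a b <= height a.
Proof. by apply: sup_curve_min_le => g; exact: curve_min_le_start. Qed.

Lemma sup_curve_minxx a : sup_curve_min a a = height a.
Proof.
apply/eqP; rewrite eq_le sup_curve_min_le_start/=.
by apply: le_trans (sup_curve_min_ge (curve_cst a)); exact: curve_min_ge.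
Qed.

Lemma sup_curve_min_sym a b : sup_curve_min a b = sup_curve_min b a.
Proof.
suff le c d : sup_curve_min c d <= sup_curve_min d c.
  by apply/eqP; rewrite eq_le !le.
apply: sup_curve_min_le => g cdg.
apply: le_trans (sup_curve_min_ge (curve_rev cdg)); apply: curve_min_ge => t.
rewrite in_itv/= => /andP[t0 t1]; apply: curve_min_le.
by rewrite in_itv/= subr_ge0 t1 gerBl.
Qed.

Lemma sup_curve_min_triangle b a c :
  Num.min (sup_curve_min a b) (sup_curve_min b c) <= sup_curve_min a c.
Proof.
rewrite leNgt; apply/negP; rewrite lt_min => /andP[ab bc].
have [_ [g abg <-] acg] := sup_gt (scm_has_sup a b).1 ab.
have [_ [h bch <-] ach] := sup_gt (scm_has_sup b c).1 bc.
have : Num.min (curve_min g) (curve_min h) <= sup_curve_min a c.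
  apply: le_trans (sup_curve_min_ge (curve_catP abg bch)).
  apply: curve_min_ge => t; rewrite in_itv/= => /andP[t0 t1].
  rewrite /curve_cat ge_min; case: (leP t 2^-1) => t2; apply/orP; [left|right];
  by apply: curve_min_le; rewrite in_itv/=; apply/andP; split; lra.
by rewrite leNgt lt_min acg ach.
Qed.

Let dKac_xx a : dKac a a = 0.
Proof. by rewrite /dKac sup_curve_minxx; lra. Qed.

Let dKac_sym a b : dKac a b = dKac b a.
Proof. by rewrite /dKac sup_curve_min_sym; lra. Qed.

Let dKac_triangle b a c : dKac a c <= dKac a b + dKac b c.
Proof.
rewrite /dKac; have := sup_curve_min_triangle b a c.
have := sup_curve_min_le_start b c; have := sup_curve_min_le_start b a.
by rewrite (sup_curve_min_sym b a) ge_min => ? ? /orP[] ?; lra.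
Qed.

Definition Kac_dist : pseudoDist R E :=
  PseudoDist dKac_xx dKac_sym dKac_triangle.

Lemma dKac_le a b : dKac a b <= mdist a b.
Proof.
have [g abg gab] := geodesic_curve a b (pgc_geodesic E).
suff : height a + height b - mdist a b <= 2 * curve_min g.
  by have := sup_curve_min_ge abg; rewrite /dKac; lra.
rewrite -ler_pdivrMl//; apply: curve_min_ge => t /gab <-.
have := metric_triangle (base E) (g t) a; have := metric_triangle (base E) (g t) b.
by rewrite (metric_sym a (g t)) ler_pdivrMl//; lra.
Qed.

Lemma Kac_compact : compact [set: mquot Kac_dist].
Proof.
apply: (@lipschitz_onto_compact R E (mquot Kac_dist) (mclass Kac_dist) 1) => //.
- by move=> a b; rewrite mdist_mclass mul1r; exact: dKac_le.
- by move=> q; exists (mrepr q); exact: mreprK.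
- exact: space_compact.
Qed.

Definition Kac : pcMetric R :=
  @PCMetric R (mquot Kac_dist) (mclass Kac_dist (base E)) Kac_compact.

End Kac.

(* Main.v *)
(** Gromov-Hausdorff convergence amounts to the existence of correspondences of
    vanishing distortion.  Given such a correspondence between [r G] and [E], a
    path of [G] whose heights are at least [m] is carried to a chain in [E] with
    steps of size [r + e], which geodesics turn into a curve staying above
    [r m - 2 e - r].  Conversely, a curve of [E] is followed by a chain in [G],
    whose consecutive points are joined by shortest paths.  So the same pairs
    of points form a correspondence between the cactuses, of distortion at most
    [6 e + 2 r].  That [E] is geodesic comes from taking the limit, along an
    ultrafilter, of discretized shortest paths of [G n] transported to [E]. *)

Require Import Defs.
From mathcomp Require Import all_boot all_order all_algebra.
From mathcomp Require Import all_classical all_reals interval_inference.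
From mathcomp Require Import ereal topology normedtype sequences.
From mathcomp Require Import lra.

Import Order.TTheory GRing.Theory Num.Theory.
Import numFieldNormedType.Exports.

Local Open Scope classical_set_scope.
Local Open Scope ring_scope.

(** * Correspondences and the Gromov-Hausdorff distance *)

Definition correspondence {R : realType} {X Y : pcMetric R} (e : R)
    (C : X -> Y -> Prop) : Prop :=
  [/\ forall x, exists y, C x y, forall y, exists x, C x y,
      C (base X) (base Y)
    & forall x y x' y', C x y -> C x' y' ->
        `|mdist x x' - mdist y y'| <= e].

(* The spaces are glued by putting related points at distance [e]; since
   the distortion is at most [e], this is compatible with the triangle inequality. *)
Section Glue.
Context {R : realType} {X Y : pcMetric R} (e : R) (C : X -> Y -> Prop).
Hypotheses (e0 : 0 < e) (CXY : correspondence e C).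

(** Length of the best route from [x] to [y] that jumps once between related points, a jump costing
    [e]. *)
Let cross (x : X) (y : Y) : R :=
  inf [set z | exists x' y', C x' y' /\ z = mdist x x' + e + mdist y' y].

Let cross_le x y x' y' : C x' y' -> cross x y <= mdist x x' + e + mdist y' y.
Proof.
move=> xy; apply: ge_inf; last by exists x', y'.
exists 0 => _ [u [v [_ ->]]].
by rewrite !addr_ge0 ?mdist_ge0// ltW.
Qed.

Let cross_ge x y z :
  (forall x' y', C x' y' -> z <= mdist x x' + e + mdist y' y) -> z <= cross x y.
Proof.
move=> zle; apply: lb_le_inf => [|_ [u [v [uv ->]]]]; last exact: zle.
by have [_ _ b _] := CXY; eexists; exists (base X), (base Y).
Qed.

Let cross_ler x' x y : cross x y <= mdist x x' + cross x' y.
Proof.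
rewrite -lerBlDl; apply: cross_ge => u v uv.
have := cross_le x y u v uv; have := metric_triangle x x' u; lra.
Qed.

Let cross_lel y' x y : cross x y <= cross x y' + mdist y' y.
Proof.
rewrite -lerBlDr; apply: cross_ge => u v uv.
have := cross_le x y u v uv; have := metric_triangle v y' y; lra.
Qed.

(** A route to [y] and back jumps twice, which costs [2 * e]; exchanging [v], [v'] for [u], [u']
    takes only [e] of it. *)
Let mdist_crossl y x x' : mdist x x' <= cross x y + cross x' y.
Proof.
rewrite -lerBlDr; apply: cross_ge => u v uv.
rewrite lerBlDr -lerBlDl; apply: cross_ge => u' v' uv'.
have [_ _ _ dis] := CXY.
have := dis _ _ _ _ uv uv'; rewrite ler_norml => /andP[? ?].
have := metric_triangle x u x'; have := metric_triangle u u' x'.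
have := metric_triangle v y v'.
rewrite (metric_sym x' u') (metric_sym v' y); have := e0; lra.
Qed.

Let mdist_crossr x y y' : mdist y y' <= cross x y + cross x y'.
Proof.
rewrite -lerBlDr; apply: cross_ge => u v uv.
rewrite lerBlDr -lerBlDl; apply: cross_ge => u' v' uv'.
have [_ _ _ dis] := CXY.
have := dis _ _ _ _ uv uv'; rewrite ler_norml => /andP[? ?].
have := metric_triangle y v y'; have := metric_triangle v v' y'.
have := metric_triangle u x u'.
rewrite (metric_sym v y) (metric_sym u x); have := e0; lra.
Qed.

Definition glue_fun (s t : X + Y) : R :=
  match s, t with
  | inl x, inl x' => mdist x x'
  | inr y, inr y' => mdist y y'
  | inl x, inr y | inr y, inl x => cross x y
  end.

Let glue_xx s : glue_fun s s = 0.
Proof. by case: s => ? /=; rewrite mdistxx. Qed.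

Let glue_sym s t : glue_fun s t = glue_fun t s.
Proof. by case: s => ?; case: t => ? //=; rewrite metric_sym. Qed.

Let glue_triangle t s u : glue_fun s u <= glue_fun s t + glue_fun t u.
Proof.
case: s => s; case: t => t; case: u => u /=; try exact: metric_triangle.
- exact: cross_ler.
- exact: mdist_crossl.
- exact: cross_lel.
- by rewrite addrC (metric_sym t u) cross_ler.
- exact: mdist_crossr.
- by rewrite addrC (metric_sym s t) cross_lel.
Qed.

Definition glue : pseudoDist R (X + Y)%type :=
  PseudoDist glue_xx glue_sym glue_triangle.

Lemma glue_correspondence x y : C x y -> glue (inl x) (inr y) <= e.
Proof.
by move=> xy; rewrite (le_trans (cross_le x y x y xy))// !mdistxx add0r addr0.
Qed.

(** Both spaces embed in the quotient of the glued pseudo-distance. The factor 2 puts related points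
    strictly inside the open balls of [hausdorff_dist]. *)
Lemma correspondence_gh_dist_le : (gh_dist X Y <= (2 * e)%:E)%E.
Proof.
have [CX CY Cb _] := CXY.
apply: ge_ereal_inf; eexists.
  exists (mquot glue), (mclass glue \o inl), (mclass glue \o inr).
  by split=> [x x'|y y'|//]; rewrite mdist_mclass.
have near x y : C x y ->
    mdist (mclass glue (inl x)) (mclass glue (inr y)) < 2 * e.
  by move=> /glue_correspondence; rewrite mdist_mclass; have := e0; lra.
rewrite ge_max lee_fin; apply/andP; split; last exact/ltW/near.
apply: ge_ereal_inf; exists (2 * e)%:E => //; exists (2 * e) => //.
split=> [||]; first by have := e0; lra.
- move=> _ [x _ <-]; have [y xy] := CX x.
  exists (mclass glue (inr y)); first by exists y.
  by rewrite ballEmdist/= metric_sym near.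
- move=> _ [y _ <-]; have [x xy] := CY y.
  exists (mclass glue (inl x)); first by exists x.
  by rewrite ballEmdist/= near.
Qed.

End Glue.

(** Points are related when their images in a common space are less than [e] apart; each end of a
    distance then moves by less than [e]. *)
Lemma gh_dist_correspondence (R : realType) (X Y : pcMetric R) (e : R) :
  (gh_dist X Y < e%:E)%E ->
  exists C : X -> Y -> Prop, correspondence (2 * e) C.
Proof.
move=> /ereal_inf_lt[_ [F [f [g [isof isog ->]]]]].
rewrite gt_max lte_fin => /andP[/ereal_inf_lt[_ [k [k0 fg gf] <-]]].
rewrite lte_fin => ke bfg.
exists (fun x y => mdist (f x) (g y) < e); split=> //.
- move=> x; have [|_ [y _ <-]] := fg (f x); first by exists x.
  by rewrite ballEmdist/= => gfx; exists y; rewrite metric_sym (lt_trans gfx).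
- move=> y; have [|_ [x _ <-]] := gf (g y); first by exists y.
  by rewrite ballEmdist/= => gfx; exists x; rewrite (lt_trans gfx).
- move=> x y x' y' xy xy'; rewrite -(isof x) -(isog y) ler_norml.
  have := metric_triangle (f x) (g y) (f x').
  have := metric_triangle (g y) (g y') (f x').
  have := metric_triangle (g y) (f x) (g y').
  have := metric_triangle (f x) (f x') (g y').
  rewrite (metric_sym (g y) (f x)) (metric_sym (g y') (f x')) => *.
  by apply/andP; split; lra.
Qed.

Lemma gh_cvg_correspondence (R : realType) (X : nat -> pcMetric R)
    (Y : pcMetric R) :
  gh_cvg X Y <-> forall e, 0 < e ->
    \forall n \near \oo, exists C : X n -> Y -> Prop, correspondence e C.
Proof.
split=> [XY e e0|XY P].
- have e20 : 0 < e / 2 by rewrite divr_gt0.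
  have XYe : \forall n \near \oo, (gh_dist (X n) Y < (e / 2)%:E)%E.
    exact: XY _ (nbhs_open_ereal_lt (f := fun=> e / 2) e20).
  apply: filterS XYe => n /gh_dist_correspondence[C].
  by rewrite mulrC divfK// => ?; exists C.
- rewrite -[nbhs 0%E P]/(nbhs (0 : R) (fun s => P s%:E)).
  move=> /nbhs_ballP[/= e e0 eP].
  have e40 : 0 < e / 4 by rewrite divr_gt0.
  (* Distortion [e / 4] bounds the distance by [e / 2], strictly below the radius [e]; nonnegativity
     excludes the value [-oo]. *)
  apply: filterS (XY _ e40) => n [C /(correspondence_gh_dist_le _ _ e40)].
  have : (0 <= gh_dist (X n) Y)%E.
    apply/ereal_infP => _ [F [f [g [_ _ ->]]]].
    by rewrite le_max lee_fin mdist_ge0 orbT.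
  rewrite /=; case: (gh_dist _ _) => [s| |]//; rewrite !lee_fin => s0 se.
  by apply: eP; rewrite /ball/= sub0r normrN ger0_norm//; lra.
Qed.

(** * Geodesicity of the limit space *)

(** The distances between [x], [q i], [q j] and [y] are at most the expected ones and add up to at
    least [gdist x y], so none is smaller. *)
Lemma gdist_geodesic (G : pgraph) (x y : G) :
  exists q : nat -> G, [/\ q 0 = x, q (gdist x y) = y
    & forall i j, (i <= j <= gdist x y)%N -> gdist (q i) (q j) = (j - i)%N].
Proof.
have [p /andP[/(pathP x) px /eqP py] psz] := gdist_path x y.
pose q := nth x (x :: p).
have qL : q (gdist x y) = y by rewrite /q -psz nth_last.
have step i k : (i + k <= gdist x y)%N -> (gdist (q i) (q (i + k)) <= k)%N.
  elim: k => [|k IH]; first by rewrite addn0 gdistxx.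
  rewrite addnS => ikL; rewrite -[leqRHS]addn1.
  apply: leq_trans (gdist_triangle (q (i + k)) _ _) _.
  apply: leq_add; first exact/IH/ltnW.
  rewrite (@gdist_le _ _ _ [:: q (i + k).+1])// /gpath/= eqxx !andbT.
  by apply: px; rewrite psz.
exists q; split=> // i j /andP[ij jL]; apply/eqP; rewrite eqn_leq.
have := step i (j - i)%N; rewrite subnKC// => /(_ jL) -> /=.
have := step 0 i; rewrite add0n => /(_ (leq_trans ij jL)) q0i.
have := step j (gdist x y - j)%N; rewrite subnKC// qL => /(_ (leqnn _)) qjL.
rewrite -(leq_add2l i) subnKC// -(leq_add2r (gdist x y - j)) subnKC//.
apply: leq_trans (gdist_triangle (q j) _ _) _; apply: leq_add => //.
by apply: leq_trans (gdist_triangle (q i) _ _) _; apply: leq_add.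
Qed.

(** An ultrafilter [V] refining [h @ U] converges by compactness. A set of [V] has its preimage in
    [U], since otherwise its complement would also belong to [V]. *)
Lemma ultra_compact_cvg (R : realType) (X : metricType R) (I : Type)
    (U : set_system I) (h : I -> X) :
  compact [set: X] -> UltraFilter U -> exists x : X, h @ U --> x.
Proof.
move=> cX UU.
have hU : ProperFilter (h @ U) by exact: fmap_proper_filter.
have [V [VU hUV]] := ultraFilterLemma hU.
have [x [_ Vx]] : [set: X] `&` [set x : X | V --> x] !=set0.
  by move: cX; rewrite compact_ultra; apply => //; exact: filterT.
exists x => A /Vx VA.
have [//|hUnA] := in_ultra_setVsetC (h @^-1` A) UU.
have /filter_ex[z []] : V (A `&` ~` A) by apply: filterI VA (hUV _ hUnA).
by [].
Qed.

(** Approximate geodesics of error [1 / (n + 1)] are taken to the limit along one nonprincipal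
    ultrafilter, which serves all times at once. *)
Lemma compact_geodesic (R : realType) (X : metricType R) :
  compact [set: X] ->
  (forall (a b : X) (e : R), 0 < e -> exists f : R -> X,
    [/\ mdist (f 0) a <= e, mdist (f (mdist a b)) b <= e
      & {in `[0, mdist a b] &, forall s t,
          `|mdist (f s) (f t) - `|s - t| | <= e}]) ->
  geodesic X.
Proof.
move=> cX approx a b.
have [h hP] := choice (fun n => approx a b n.+1%:R^-1 (ltac:(by []))).
have [U [UU ooU]] := ultraFilterLemma eventually_filter.
have [f hf] := choice (fun t => ultra_compact_cvg R X nat U (h^~ t) cX UU).
have close t (e : R) : 0 < e -> U [set n | mdist (f t) (h n t) < e].
  move=> e0; have /= := hf t _ (nbhsx_ballx (f t) e e0).
  by rewrite ballEmdist.
have small (e : R) : 0 < e -> U [set n | n.+1%:R^-1 < e].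
  by move=> e0; apply: ooU; exact: near_infty_natSinv_lt (PosNum e0).
have UI (P Q : set nat) : U P -> U Q -> U (P `&` Q) by exact: filterI.
have limE s x : (forall n, mdist (h n s) x <= n.+1%:R^-1) -> f s = x.
  move=> hx; apply: mdist_positivity; apply/eqP; rewrite eq_le mdist_ge0 andbT.
  apply/ler_addgt0Pl => e e0; rewrite addr0.
  have e20 : 0 < e / 2 by rewrite divr_gt0.
  have /filter_ex[n [/= fh ne]] := UI _ _ (close s _ e20) (small _ e20).
  move: (hx n) ne; move: (_^-1) => k.
  have := metric_triangle (f s) (h n s) x; lra.
exists f; split.
- by apply: limE => n; have [] := hP n.
- by apply: limE => n; have [] := hP n.
- move=> s t sD tD.
  suff : `|mdist (f s) (f t) - `|s - t| | <= 0.
    by rewrite normr_le0 subr_eq0 => /eqP.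
  apply/ler_addgt0Pl => e e0; rewrite addr0.
  have e30 : 0 < e / 3 by rewrite divr_gt0.
  have /filter_ex[n [/= [sh th] ne]] :=
    UI _ _ (UI _ _ (close s _ e30) (close t _ e30)) (small _ e30).
  have [_ _ /(_ s t sD tD)] := hP n; move: (_^-1) ne => k ne.
  have := metric_triangle (f s) (h n s) (f t).
  have := metric_triangle (h n s) (h n t) (f t).
  have := metric_triangle (h n s) (f s) (h n t).
  have := metric_triangle (f s) (f t) (h n t).
  rewrite (metric_sym (h n s) (f s)) (metric_sym (h n t) (f t)).
  by rewrite !ler_norml => ? ? ? ? /andP[? ?]; apply/andP; split; lra.
Qed.

(** A shortest path between vertices related to [a] and [b] is carried to [X] by a choice [phi] of
    related points. Each of the two times is off by at most [r + e], and the distortion adds [e]. *)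
Lemma correspondence_approx_geodesic (R : realType) (r : {posnum R})
    (G : pgraph) (X : pcMetric R) (e : R)
    (C : rescale r (graph_space R G) -> X -> Prop) (a b : X) :
  0 < e -> correspondence e C ->
  exists f : R -> X,
    [/\ mdist (f 0) a <= 3 * e + 2 * r%:num,
        mdist (f (mdist a b)) b <= 3 * e + 2 * r%:num
      & {in `[0, mdist a b] &, forall s t,
          `|mdist (f s) (f t) - `|s - t| | <= 3 * e + 2 * r%:num}].
Proof.
move=> e0 [CX CE _ dis].
have r0 : 0 < r%:num by [].
have [x xa] := CE a; have [y yb] := CE b.
have [q [q0 qL qij]] := gdist_geodesic G x y.
have [phi Cphi] := choice CX.
set L := gdist x y in qL qij.
have distE (u v : G) : mdist (u : rescale r (graph_space R G)) v =
  r%:num * (gdist u v)%:R by [].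
set D := mdist a b.
have LD : `|r%:num * L%:R - D| <= e by have := dis _ _ _ _ xa yb; rewrite distE.
(* Index of the vertex reached at time [t], capped at [L] because [r * L] may fall short of [D] by
   up to [e]. *)
pose k (t : R) := minn (Num.truncn (t / r%:num)) L.
have kL t : (k t <= L)%N by exact: geq_minr.
have kt t : t \in `[0, D] -> `|r%:num * (k t)%:R - t| <= r%:num + e.
  rewrite in_itv/= => /andP[t0 tD].
  have tr0 : 0 <= t / r%:num by rewrite divr_ge0.
  have /andP[] := truncn_itv tr0.
  rewrite ler_pdivlMr// ltr_pdivrMr// -natr1 mulrDl mul1r mulrC => kt1 kt2.
  move: LD; rewrite !ler_norml /k => /andP[? ?].
  have [kL'|Lk] := leqP (Num.truncn (t / r%:num)) L.
    by apply/andP; split; lra.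
  have : r%:num * L%:R <= r%:num * (Num.truncn (t / r%:num))%:R.
    by rewrite ler_pM2l// ler_nat ltnW.
  by move=> ?; apply/andP; split; lra.
have phiq i j : (i <= j <= L)%N ->
    `|mdist (phi (q i)) (phi (q j)) - r%:num * (j%:R - i%:R)| <= e.
  move=> ijL; have := dis _ _ _ _ (Cphi (q i)) (Cphi (q j)).
  by rewrite distE qij// distrC natrB//; case/andP: ijL.
exists (fun t => phi (q (k t))); split.
- rewrite /k mul0r truncn0 min0n q0.
  have := dis _ _ _ _ (Cphi x) xa.
  rewrite distE gdistxx mulr0 sub0r normrN ger0_norm ?mdist_ge0//; lra.
- have := dis _ _ _ _ (Cphi (q (k D))) yb.
  rewrite distE -qL qij ?kL ?leqnn// natrB ?kL//.
  have /kt : D \in `[0, D] by rewrite in_itv/= lexx mdist_ge0.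
  move: LD; rewrite !ler_norml mulrBr => /andP[? ?] /andP[? ?] /andP[? ?]; lra.
- have main s t : s \in `[0, D] -> t \in `[0, D] -> s <= t ->
    `|mdist (phi (q (k s))) (phi (q (k t))) - `|s - t| | <=
      3 * e + 2 * r%:num.
    move=> sD tD st.
    have kst : (k s <= k t)%N.
      rewrite leq_min kL andbT (leq_trans (geq_minl _ _))// le_truncn//.
      by rewrite ler_pM2r// invr_gt0.
    have := phiq (k s) (k t); rewrite kst kL => /(_ isT).
    rewrite (ler0_norm (_ : s - t <= 0)) ?subr_le0// mulrBr.
    have := kt _ sD; have := kt _ tD.
    rewrite !ler_norml => /andP[? ?] /andP[? ?] /andP[? ?].
    by apply/andP; split; lra.
  move=> s t sD tD; have [st|/ltW ts] := leP s t; first exact: main.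
  by rewrite metric_sym (distrC s t) main.
Qed.

(** * Comparison of the cactus distances *)

(** Along a geodesic the height drops by at most the length; [dKac_le] encodes this. *)
Lemma sup_curve_min_step (R : realType) (E : pgcMetric R) (a b : E) :
  mdist (base E) a - mdist a b <= sup_curve_min a b.
Proof.
have := dKac_le a b; rewrite /dKac.
have := metric_triangle (base E) b a; rewrite (metric_sym b a); lra.
Qed.

(** An initial segment of a shortest path joins [x] to any of its vertices, so the height drops by
    at most [gdist x y]. *)
Lemma max_path_min_step (G : pgraph) (x y : G) :
  (gdist (Defs.root G) x - gdist x y <= max_path_min x y)%N.
Proof.
have [p xpy psz] := gdist_path x y.
apply/leq_max_path_min; exists p => //; apply/allP => z zp.
rewrite leq_subLR addnC.
apply: leq_trans (gdist_triangle z _ _) _; rewrite leq_add2l gdist_sym -psz.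
have /andP[px _] := xpy; case/splitPl: zp px => p1 p2 zE.
rewrite cat_path => /andP[p1x _].
have /gdist_le xz : gpath x z p1 by rewrite /gpath p1x zE eqxx.
by rewrite (leq_trans xz)// size_cat leq_addr.
Qed.

(* Connectedness of [0, 1]; it replaces the choice of a subdivision fine enough
   for the modulus of continuity of a curve. *)
Lemma itv01_ind (R : realType) (P : R -> Prop) :
  (forall t, t \in `[0, 1] -> exists2 k, 0 < k &
    forall s, s \in `[0, 1] -> `|t - s| < k -> (P t <-> P s)) ->
  P 0 -> P 1.
Proof.
move=> Ploc P0; pose A := [set t | t \in `[0, 1] /\ P t].
have i0 : 0 \in `[(0 : R), 1] by rewrite in_itv/= lexx ler01.
have A0 : A 0 by [].
have supA : has_sup A.
  by split; [exists 0|exists 1 => t [/itvP-> _]].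
have sup01 : sup A \in `[0, 1].
  rewrite in_itv/= ub_le_sup//=; last exact: supA.2.
  by apply: ge_sup => [|t [/itvP-> _]]; first by exists 0.
have [k k0 kP] := Ploc _ sup01.
have Psup : P (sup A).
  have [t [t01 Pt] tA] := sup_adherent k0 supA; apply/(kP t) => //.
  have := ub_le_sup supA.2 (conj t01 Pt) => tsup.
  by rewrite ger0_norm ?subr_ge0// ltrBlDr -ltrBlDl.
have [->//|sup1] := eqVneq 1 (sup A).
(* If the supremum were below 1, [P] would still hold at this point beyond it. *)
pose s := Num.min 1 (sup A + k / 2).
have s01 : s \in `[0, 1].
  move: sup01; rewrite !in_itv/= le_min ge_min lexx ler01/= => /andP[? ?].
  by rewrite andbT; lra.
have sups : sup A < s.
  rewrite lt_min lt_neqAle eq_sym sup1/= (itvP sup01)/=; lra.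
have Ps : P s.
  apply/(kP s) => //; rewrite ltr0_norm ?subr_lt0// opprB.
  have : s <= sup A + k / 2 by rewrite ge_min lexx orbT.
  by move=> ?; lra.
by have := ub_le_sup supA.2 (conj s01 Ps : A s); rewrite leNgt sups.
Qed.

Section CactusDistortion.
Context {R : realType} (r : {posnum R}) (G : pgraph) (E : pgcMetric R).
Context (e : R) (C : rescale r (graph_space R G) -> E -> Prop).
Hypothesis CGE : correspondence e C.

Let dist_le (v w : G) (a b : E) : C v a -> C w b ->
  mdist a b - e <= r%:num * (gdist v w)%:R <= mdist a b + e.
Proof.
have [_ _ _ dis] := CGE => va wb; have := dis _ _ _ _ va wb.
rewrite mdist_rescaled mdist_gspace ler_norml => /andP[? ?].
by apply/andP; split; lra.
Qed.

Let scale_le (m n : nat) : (m <= n)%N -> r%:num * m%:R <= r%:num * n%:R.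
Proof. by move=> mn; rewrite ler_pM2l ?ler_nat. Qed.

Let height_le (v : G) (a : E) : C v a -> mdist (base E) a - e <=
  r%:num * (gdist (Defs.root G) v)%:R <= mdist (base E) a + e.
Proof. by have [_ _ Cb _] := CGE => va; exact: dist_le. Qed.

(* The geodesics and the shortest paths joining consecutive points enter only
   through [sup_curve_min_step] and [max_path_min_step], and concatenation only
   through the ultrametric inequalities. *)
Let max_path_min_le_sup_curve_min (v w : G) (a b : E) :
  C v a -> C w b ->
  r%:num * (max_path_min v w)%:R <= sup_curve_min a b + 2 * e + r%:num.
Proof.
move=> va wb; have r0 : 0 < r%:num by [].
have [CG _ _ _] := CGE.
have step (u u' : G) (c c' : E) (m : nat) : C u c -> C u' c' ->
    (m <= gdist (Defs.root G) u)%N -> (gdist u u' <= 1)%N ->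
    r%:num * m%:R <= sup_curve_min c c' + 2 * e + r%:num.
  move=> uc uc' /scale_le mu /scale_le uu'.
  have := sup_curve_min_step _ _ c c'.
  have /andP[? ?] := height_le _ _ uc.
  have /andP[? ?] := dist_le _ _ _ _ uc uc'.
  lra.
have /leq_max_path_min[p] := leqnn (max_path_min v w).
(* With [m] any lower bound of the heights, the induction applies to the tail of the path. *)
move: (max_path_min v w) => m; elim: p v a va => [|u p IH] v a va.
  move=> /andP[_ /eqP/= vw] /andP[mv _]; rewrite -vw in wb.
  by apply: (step v v) => //; rewrite gdistxx.
rewrite /gpath/= => /andP[/andP[vu up] pw] /andP[mv mp].
have [c uc] := CG u.
have vu1 : (gdist v u <= 1)%N.
  by rewrite (@gdist_le _ _ _ [:: u])// /gpath/= vu eqxx.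
have vac := step _ _ _ _ _ va uc mv vu1.
have := IH u c uc; rewrite /gpath up pw => /(_ isT mp) ucb.
have := sup_curve_min_triangle c a b; rewrite ge_min => /orP[] ?; lra.
Qed.

Let sup_curve_min_le_max_path_min (v w : G) (a b : E) :
  C v a -> C w b ->
  sup_curve_min a b <= r%:num * (max_path_min v w)%:R + 2 * e.
Proof.
move=> va wb; have r0 : 0 < r%:num by [].
have [_ CE _ _] := CGE.
apply: sup_curve_min_le => g [cg g0 g1]; apply/ler_addgt0Pr => eta eta0.
set x := curve_min g.
have step (u u' : G) (c c' : E) : C u c -> C u' c' -> mdist c c' < eta ->
    x <= mdist (base E) c ->
    x <= r%:num * (max_path_min u u')%:R + 2 * e + eta.
  move=> uc uc' cc' xc.
  have := max_path_min_step _ u u'.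
  rewrite leq_subLR => /scale_le; rewrite natrD mulrDr => ?.
  have /andP[? ?] := height_le _ _ uc.
  have /andP[? ?] := dist_le _ _ _ _ uc uc'.
  lra.
(* Asking for the bound at every vertex related to [g t] lets it pass to nearby times. *)
pose P t := forall u, C u (g t) ->
  x <= r%:num * (max_path_min v u)%:R + 2 * e + eta.
have Pstep t s : t \in `[0, 1] -> mdist (g t) (g s) < eta -> P t -> P s.
  move=> t01 ts Pt u ugs; have [u' ugt] := CE (g t).
  have := step _ _ _ _ ugt ugs ts (curve_min_le _ t01).
  have := Pt _ ugt; have := max_path_min_triangle u' v u.
  by rewrite geq_min => /orP[] /scale_le ? ? ?; lra.
suff : P 1 by apply; rewrite g1.
(* Continuity of [g] keeps images of nearby times less than [eta] apart, so [P] is locally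
   constant. *)
apply: (itv01_ind _ P) => [t t01|u].
  have /within_continuousP/(_ t t01 _ eta0)[k k0 kP] := cg.
  exists k => // s s01 ts; have gts := kP s s01 ts.
  by split; apply: Pstep => //; rewrite metric_sym.
rewrite g0 => ua; apply: (step _ _ _ _ va ua); first by rewrite mdistxx.
by rewrite -g0 curve_min_le// in_itv/= lexx ler01.
Qed.

(** Classes are related through some related representatives, which compute their distances. The two
    heights contribute [2 * e] and the doubled minima [2 * (2 * e + r)]. *)
Lemma Cac_Kac_correspondence : correspondence (6 * e + 2 * r%:num)
  (fun (p : rescale r (Cac R G)) (q : Kac E) => exists (v : G) (a : E),
    [/\ mclass (Cac_dist R G) v = p, mclass (Kac_dist E) a = q & C v a]).
Proof.
have [CG CE Cb _] := CGE; split.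
- move=> p; have [a va] := CG (mrepr p).
  exists (mclass (Kac_dist E) a), (mrepr p), a; split=> //; exact: mreprK.
- move=> q; have [v va] := CE (mrepr q).
  exists (mclass (Cac_dist R G) v), v, (mrepr q); split=> //; exact: mreprK.
- by exists (Defs.root G), (base E).
- move=> _ _ _ _ [v [a [<- <- va]]] [w [b [<- <- wb]]].
  rewrite mdist_rescaled !mdist_mclass /= /dCac /dKac.
  have := max_path_min_le_sup_curve_min _ _ _ _ va wb.
  have := sup_curve_min_le_max_path_min _ _ _ _ va wb.
  have /andP[? ?] := height_le _ _ va; have /andP[? ?] := height_le _ _ wb.
  have r0 : 0 < r%:num by [].
  rewrite mulrBr mulrDr mulrCA ler_norml => ? ?; apply/andP; split; lra.
Qed.

End CactusDistortion.

(** * Convergence of the cactuses *)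

Theorem proposition2p8 (R : realType) (G : nat -> pgraph)
    (r : nat -> {posnum R}) (E : pcMetric R)
    (r_cvg : (r n)%:num @[n --> \oo] --> (0 : R))
    (G_cvg : gh_cvg (fun n => rescale (r n) (graph_space R (G n))) E) :
  exists geoE : geodesic E,
    gh_cvg (fun n => rescale (r n) (Cac R (G n))) (Kac (PGCMetric geoE)).
Proof.
have approx e : 0 < e -> \forall n \near \oo, (r n)%:num < e /\
    exists C : rescale (r n) (graph_space R (G n)) -> E -> Prop,
      correspondence e C.
  move=> e0; apply: filterS2 (cvgr_lt 0 r_cvg e e0)
    ((gh_cvg_correspondence _ _ _).1 G_cvg e e0) => n; exact: conj.
have geoE : geodesic E.
  apply: compact_geodesic (@space_compact R E) _ => a b e e0.
  (* The error [3 * (e / 5) + 2 * r n] is below [e] once [r n < e / 5]. *)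
  have e5 : 0 < e / 5 by rewrite divr_gt0.
  have /filter_ex[n [rn [C CGE]]] := approx _ e5.
  have [f [fa fb fD]] := correspondence_approx_geodesic _ _ _ _ _ _ a b e5 CGE.
  have le : 3 * (e / 5) + 2 * (r n)%:num <= e by lra.
  exists f; split; [exact: le_trans fa le|exact: le_trans fb le|].
  by move=> s t sD tD; apply: le_trans (fD s t sD tD) le.
exists geoE; apply/gh_cvg_correspondence => e e0.
(* Likewise for the distortion [6 * (e / 8) + 2 * r n]. *)
have e8 : 0 < e / 8 by rewrite divr_gt0.
apply: filterS (approx _ e8) => n [rn [C CGE]].
have [CC CK Cb dis] :=
  Cac_Kac_correspondence _ _ (PGCMetric geoE) _ _ CGE.
eexists; split; [exact: CC|exact: CK|exact: Cb|].
move=> p q p' q' pq pq'; apply: le_trans (dis _ _ _ _ pq pq') _; lra.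
Qed.
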